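(* For any multiquiver $\Gamma=(V,E,s,t)$, the TGW datum $(R_E,\sigma^\Gamma,t^\Gamma)$ satisfies the TGW consistency conditions with all $\mu_{ij}=1$, i.e. writing $\sigma^\Gamma=(\sigma_v)_{v\in V}$ and $t^\Gamma=(t_v)_{v\in V}$: $$\sigma_i\sigma_j(t_it_j)=\sigma_i(t_i)\,\sigma_j(t_j)\quad\text{for all } i,j\in V,\ i\ne j,$$ $$\sigma_i\sigma_k(t_j)\,t_j=\sigma_i(t_j)\,\sigma_k(t_j)\quad\text{for all pairwise distinct } i,j,k\in V.$$
   Context: $\Bbbk$ is a field of characteristic zero. A multiquiver $\Gamma=(V,E,s,t)$ consists of sets $V$ (vertices), $E$ (edges) and functions $s,t:E\to (V\times\mathbb{Z}_{>0})\cup\{\emptyset\}$ such that (no loops) if $s(e)=(u,m)$ and $t(e)=(v,n)$ then $u\ne v$; and (local finiteness) for each $v\in V$ only finitely many $e$ have $s(e)\in\{v\}\times\mathbb{Z}_{>0}$ or $t(e)\in\{v\}\times\mathbb{Z}_{>0}$. Its incidence matrix $(\gamma_{ev})_{e\in E,v\in V}$ is given by $\gamma_{ev}=n$ if $t(e)=(v,n)$, $\gamma_{ev}=-n$ if $s(e)=(v,n)$, and $\gamma_{ev}=0$ otherwise. The datum $(R_E,\sigma^\Gamma,t^\Gamma)$: $R_E=\Bbbk[u_e\mid e\in E]$ (polynomial algebra); $\sigma_v$ ($v\in V$) is the $\Bbbk$-algebra automorphism of $R_E$ with $\sigma_v(u_e)=u_e-\gamma_{ev}$; $t_v=\prod_{e\in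 E}u_{ev}$ with $u_{ev}=u_e(u_e+1)\cdots(u_e+\gamma_{ev}-1)$ if $\gamma_{ev}>0$, $u_{ev}=1$ if $\gamma_{ev}=0$, and $u_{ev}=(u_e-1)(u_e-2)\cdots(u_e-|\gamma_{ev}|)$ if $\gamma_{ev}<0$. *)

(* Defs.v *)
From HB Require Import structures.
From mathcomp Require Import all_boot all_order all_algebra.
From mathcomp Require Import finmap boolp classical_sets functions cardinality.
From mathcomp Require Import fsbigop.
From mathcomp Require Import monalg.

Set Implicit Arguments.
Unset Strict Implicit.
Unset Printing Implicit Defensive.

Import Order.TTheory GRing.Theory Num.Theory.

Local Open Scope fset_scope.
Local Open Scope classical_set_scope.
Local Open Scope ring_scope.

Definition posnat := {n : nat | (0 < n)%N}.

(* [None] plays the role of the empty endpoint. *)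
Record multiquiver (V : eqType) (E : choiceType) := Multiquiver {
  mq_source : E -> option (V * posnat);
  mq_target : E -> option (V * posnat);
  mq_no_loop : forall (e : E) (u v : V) (m n : posnat),
    mq_source e = Some (u, m) -> mq_target e = Some (v, n) -> u <> v;
  mq_locally_finite : forall v : V,
    finite_set [set e : E | (exists n, mq_source e = Some (v, n)) \/
                            (exists n, mq_target e = Some (v, n))]
}.

Definition multiplicity_at (V : eqType) (x : option (V * posnat)) (v : V) :
    option nat :=
  if x is Some (w, n) then if w == v then Some (val n) else None else None.

(* By [mq_no_loop] the target and the source cannot both be at v. *)
Definition incidence (V : eqType) (E : choiceType) (G : multiquiver V E)
    (e : E) (v : V) : int :=
  match multiplicity_at (mq_target G e) v, multiplicity_at (mq_source G e) v with
  | Some n, _ => n%:Z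
  | None, Some n => - n%:Z
  | None, None => 0
  end.

Lemma incidence_target (V : eqType) (E : choiceType) (G : multiquiver V E)
  (e : E) (v : V) (n : posnat) :
  mq_target G e = Some (v, n) -> incidence G e v = (val n)%:Z.
Proof. by move=> te; rewrite /incidence te /= eqxx. Qed.

Lemma incidence_source (V : eqType) (E : choiceType) (G : multiquiver V E)
  (e : E) (v : V) (n : posnat) :
  mq_source G e = Some (v, n) -> incidence G e v = - (val n)%:Z.
Proof.
move=> se; rewrite /incidence se /= eqxx.
case te: (mq_target G e) => [[u m]|] //=.
by case: eqP (mq_no_loop se te) => [->|].
Qed.

Lemma incidence_other (V : eqType) (E : choiceType) (G : multiquiver V E)
  (e : E) (v : V) :
  (forall n, mq_target G e <> Some (v, n)) ->
  (forall n, mq_source G e <> Some (v, n)) -> incidence G e v = 0.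
Proof.
rewrite /incidence => ht hs.
suff w0 x : (forall n, x <> Some (v, n)) -> multiplicity_at x v = None.
  by rewrite !w0.
by case: x => [[w n]|] //= h; case: eqP h => // -> /(_ n).
Qed.

Lemma monomialZ (K : choiceType) (R : nzRingType) (c : R) (m : K) :
  << c *g m >> = c *: << m >> :> {malg R[K]}.
Proof. by apply/malgP => m'; rewrite mcoeffZ !mcoeffU mulrnAr mulr1. Qed.

(* k[u_e | e in E], as the monoid algebra of the free commutative monoid on E. *)
Definition polyalg (k : fieldType) (E : choiceType) : comAlgType k :=
  {malg k[{cmonom E}]}.

Definition pvar (k : fieldType) (E : choiceType) (e : E) : polyalg k E :=
  << ucm e >>.
Arguments pvar k {E} e.

Section Substitution.
Variables (k : fieldType) (E : choiceType).
Local Notation RE := (polyalg k E).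
Implicit Types (f : E -> RE).

Definition cmonom_subst f (m : {cmonom E}) : RE :=
  \prod_(e <- finsupp m) f e ^+ m e.

Lemma cmonom_substEw f (d : {fset E}) (m : {cmonom E}) :
  (finsupp m `<=` d)%fset -> cmonom_subst f m = \prod_(e <- d) f e ^+ m e.
Proof.
move=> le; rewrite /cmonom_subst [LHS](big_fset_incl _ le) //= => e _.
by rewrite -cmE_eq0 => /eqP ->; rewrite expr0.
Qed.

Lemma cmonom_subst_mmorphism f : mmorphism (cmonom_subst f).
Proof.
split=> [m1 m2|]; last by rewrite /cmonom_subst mdom1 big_seq_fset0.
pose d := (finsupp m1 `|` finsupp m2)%fset.
rewrite !(@cmonom_substEw f d) ?fsubsetUl ?fsubsetUr ?mdomD //.
by rewrite -big_split; apply: eq_bigr => e _; rewrite cmM exprD.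
Qed.

HB.instance Definition _ f := isMultiplicative.Build _ _ (cmonom_subst f)
  (cmonom_subst_mmorphism f).

(* The k-algebra endomorphism u_e |-> f e. *)
Definition psubst f : RE -> RE := mmap (@malgC _ k) (cmonom_subst f).

HB.instance Definition _ f := GRing.RMorphism.on (psubst f).

Lemma psubst_is_scalable f : scalable (psubst f).
Proof.
by move=> c p; rewrite /psubst mmapZ mul_malgC.
Qed.

HB.instance Definition _ f := GRing.isScalable.Build k RE RE *:%R (psubst f)
  (psubst_is_scalable f).

Lemma psubstX f e : psubst f (pvar k e) = f e.
Proof.
by rewrite /psubst /pvar mmapU /= mul_malgC scale1r /cmonom_subst mdomU big_seq_fset1
  cmUU.
Qed.

Lemma polyalg_monomials : exists X : {cmonom E} -> RE,
  [/\ X mone = 1, forall m1 m2, X (mmul m1 m2) = X m1 * X m2,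
      forall e, X (ucm e) = pvar k e
    & forall p : RE, p = \sum_(m <- msupp p) p@_m *: X m].
Proof.
exists (fun m => << m >>); split=> // [m1 m2|p].
  by rewrite [RHS]malgM_def fgmulUU mulr1.
rewrite [LHS]monalgE; apply: eq_bigr => m _; exact: monomialZ.
Qed.

Lemma eq_lrmorph_polyalg (g h : {lrmorphism RE -> RE}) :
  (forall e, g (pvar k e) = h (pvar k e)) -> g =1 h.
Proof.
have [X [X1 XM XU Xsum]] := polyalg_monomials; move=> ghX p.
have ghm m : g (X m) = h (X m).
  have [n] := ubnP (mdeg m); elim: n m => // n IHn m lt_mn.
  have [->|] := eqVneq m mone; first by rewrite X1 !rmorph1.
  rewrite -mdeg_eq0 => m_neq0.
  have [e em] : exists e, e \in finsupp m.
    apply/fset0Pn; apply: contraNneq m_neq0 => m0.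
    by rewrite /mdeg m0 big_seq_fset0.
  have def_m : m = mmul (ucm e) (divcm m (ucm e)).
    apply/eqP/cmP => i; rewrite cmM divcmE subnKC // cmU.
    by case: eqP => // <-; rewrite lt0n cmE_neq0.
  move: lt_mn; rewrite {}def_m; move: (divcm m _) => m'.
  rewrite mdegM mdegU add1n ltnS => /IHn ghm'.
  rewrite XM (rmorphM g) (rmorphM h) XU /= ghX ghm'; reflexivity.
rewrite [p]Xsum !linear_sum; apply: eq_bigr => m _.
by rewrite !linearZ /= ghm.
Qed.

End Substitution.

Section Datum.
Variables (k : fieldType) (V : eqType) (E : choiceType) (G : multiquiver V E).
Local Notation RE := (polyalg k E).

Definition tgw_sigma (v : V) : RE -> RE :=
  psubst (fun e => pvar k e - (incidence G e v)%:~R).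

HB.instance Definition _ v := GRing.LRMorphism.on (tgw_sigma v).

(* The [Posz] case also covers incidence 0, giving the empty product; recall
   that [Negz n] is - (n + 1). *)
Definition tfactor (e : E) (v : V) : RE :=
  match incidence G e v with
  | Posz n => \prod_(0 <= i < n) (pvar k e + i%:R)
  | Negz n => \prod_(1 <= i < n.+2) (pvar k e - i%:R)
  end.

Lemma finite_tfactor (v : V) : finite_set [set e | tfactor e v <> 1].
Proof.
apply: sub_finite_set (mq_locally_finite G v) => e /= te.
apply: contrapT => /not_orP[/forallNP hs /forallNP ht]; apply: te.
by rewrite /tfactor (_ : incidence G e v = Posz 0) ?big_geq ?incidence_other.
Qed.

(* Product over all of E of factors that are 1 outside a finite set
   ([finite_tfactor]). *)
Definition tgw_t (v : V) : RE :=
  \big[*%R/1]_(e \in [set: E]) tfactor e v.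

Lemma tgw_sigmaX v e : tgw_sigma v (pvar k e) = pvar k e - (incidence G e v)%:~R.
Proof. exact: psubstX. Qed.

Lemma psubst_shift (f : E -> RE) (c : int) e :
  psubst f (pvar k e + c%:~R) = f e + c%:~R.
Proof. by rewrite (rmorphD (psubst f)) rmorph_int /= psubstX. Qed.

Lemma tgw_sigma_comm v w : tgw_sigma v \o tgw_sigma w =1 tgw_sigma w \o tgw_sigma v.
Proof.
apply: (@eq_lrmorph_polyalg k E (tgw_sigma v \o tgw_sigma w) (tgw_sigma w \o tgw_sigma v)) => e.
rewrite [LHS]/= [RHS]/= !tgw_sigmaX -!mulrNz /tgw_sigma !psubst_shift -!mulrNz.
exact: addrAC.
Qed.

Lemma tgw_sigma_bij v : bijective (tgw_sigma v).
Proof.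
exists (psubst (fun e => pvar k e + (incidence G e v)%:~R)).
  apply: (@eq_lrmorph_polyalg k E (psubst _ \o tgw_sigma v) idfun) => e.
  rewrite [LHS]/= tgw_sigmaX -mulrNz psubst_shift mulrNz; exact: addrK.
apply: (@eq_lrmorph_polyalg k E (tgw_sigma v \o psubst _) idfun) => e.
rewrite [LHS]/= psubstX /tgw_sigma psubst_shift; exact: subrK.
Qed.

End Datum.

Arguments tgw_sigma k {V E} G v _.
Arguments tfactor k {V E} G e v.
Arguments tgw_t k {V E} G v.

(* Main.v *)
Require Import Defs.
From HB Require Import structures.
From mathcomp Require Import all_boot all_order all_algebra.
From mathcomp Require Import finmap boolp classical_sets cardinality.
From mathcomp Require Import fsbigop.

(** Both identities hold edge by edge.  An edge [e] has at most two nonzero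
incidences, and if it has two they are [n > 0] at its target and [- m < 0] at
its source.  With [u := u_e], both sides of the first identity then have the
factor [(u - n) (u - n + 1) ... (u + m - 1)] at [e]; otherwise one of the two
automorphisms fixes [u].  In the second identity, either the factor of [t_j]
at [e] is 1, or one of the two automorphisms fixes [u]. *)

Set Implicit Arguments.
Unset Strict Implicit.
Unset Printing Implicit Defensive.

Import Order.TTheory GRing.Theory Num.Theory.

Local Open Scope ring_scope.

Section RisingFactorial.
Variable R : comNzRingType.
Implicit Types (x : R) (m n : nat) (a b : int).

Definition rising x n : R := \prod_(0 <= i < n) (x + i%:R).

Lemma risingD x m n : rising x (m + n) = rising x m * rising (x + m%:R) n.
Proof.
rewrite /rising (big_cat_nat (n := m)) ?leq_addr //=; congr (_ * _).
rewrite -{1}[m]add0n big_addn addKn.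
by apply: eq_bigr => i _; rewrite natrD -addrA [i%:R + _]addrC.
Qed.

(** For negative [a] this is (x - |a|) ... (x - 1), read upwards so that both signs are rising
    factorials and [risingD] applies to both. *)
Definition signed_rising x a : R :=
  match a with
  | Posz n => rising x n
  | Negz n => rising (x - n.+1%:R) n.+1
  end.

Lemma signed_rising0 x : signed_rising x 0 = 1.
Proof. by rewrite /= /rising big_geq. Qed.

(** Reversing the index gives the order in which [tfactor] lists its factors. *)
Lemma signed_rising_Negz x n :
  signed_rising x (Negz n) = \prod_(1 <= i < n.+2) (x - i%:R).
Proof.
rewrite /= /rising [RHS]big_nat_rev /= big_add1 /=.
apply: eq_big_nat => i /andP[_ lt_in].
by rewrite !subSS natrB 1?ltnW // opprB addrA addrAC.
Qed.

(** The hypotheses leave opposite signs, or an argument equal to 0, whose factor is 1 and whose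
    shift is trivial. *)
Lemma signed_rising_exchange x a b :
  (0 < a -> b <= 0) -> (a < 0 -> 0 <= b) ->
  signed_rising (x - a%:~R - b%:~R) a * signed_rising (x - a%:~R - b%:~R) b =
  signed_rising (x - a%:~R) a * signed_rising (x - b%:~R) b.
Proof.
have PN n m y : signed_rising (y - (Posz n)%:~R - (Negz m)%:~R) (Posz n) *
    signed_rising (y - (Posz n)%:~R - (Negz m)%:~R) (Negz m) =
    signed_rising (y - (Posz n)%:~R) (Posz n) *
    signed_rising (y - (Negz m)%:~R) (Negz m).
  (* Each side is the run of n + m + 1 consecutive factors starting at y - n, cut after m + 1
     factors on the left and after n on the right. *)
  rewrite /= !NegzE !mulrNz !opprK -!pmulrn !addrK mulrC -risingD addnC risingD.
  by rewrite subrK.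
case: a b => n [] m ab ba.
(* [Posz] includes 0; of two such arguments one must vanish. *)
- case: n ab {ba} => [_|n /(_ isT)].
    by rewrite !signed_rising0 subr0 !mul1r.
  by case: m => // _; rewrite !signed_rising0 subr0 !mulr1.
- exact: PN.
(* The identity is symmetric in [a] and [b]. *)
- by rewrite mulrC addrAC PN mulrC.
- by have := ba isT.
Qed.

End RisingFactorial.

Lemma rmorph_signed_rising (R S : comNzRingType) (f : {rmorphism R -> S}) x a :
  f (signed_rising x a) = signed_rising (f x) a.
Proof.
have fr y n : f (rising y n) = rising (f y) n.
  by rewrite rmorph_prod; apply: eq_bigr => i _; rewrite rmorphD rmorph_nat.
by case: a => n; rewrite /= fr // rmorphB rmorph_nat.
Qed.

(* Stated for abstract rings and morphisms: rewriting with [rmorphM] directly in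
   [polyalg k E] unfolds the polynomials and diverges. *)
Section ShiftMorphisms.
Variables (R : comNzRingType) (f g : {rmorphism R -> R}) (x : R) (a b c : int).
Hypotheses (fx : f x = x - a%:~R) (gx : g x = x - b%:~R).

Let fgx : f (g x) = x - a%:~R - b%:~R.
Proof. by rewrite gx rmorphB rmorph_int fx. Qed.

Lemma shift_exchange : (0 < a -> b <= 0) -> (a < 0 -> 0 <= b) ->
  f (g (signed_rising x a * signed_rising x b)) =
  f (signed_rising x a) * g (signed_rising x b).
Proof.
move=> ab ba; rewrite !rmorphM !rmorph_signed_rising fgx fx gx.
exact: signed_rising_exchange.
Qed.

(** Intended for [a], [c], [b] the incidences of one edge at i, j, l; the cases come in the order of
    [incidence_three]. *)
Lemma shift_parallelogram : [\/ a = 0, c = 0 | b = 0] ->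
  f (g (signed_rising x c)) * signed_rising x c =
  f (signed_rising x c) * g (signed_rising x c).
Proof.
rewrite !rmorph_signed_rising fgx fx gx => -[->|->|->].
- by rewrite subr0 mulrC.
- by rewrite !signed_rising0.
- by rewrite !subr0.
Qed.

End ShiftMorphisms.

Section ProdMorphisms.
Variables (R : comNzRingType) (f g : {rmorphism R -> R}).
Variables (I : Type) (r : seq I) (F H : I -> R).

(** All operations involved are multiplicative, so an identity for each edge passes to finite
    products. *)
Lemma prod_exchange :
  (forall i, f (g (F i * H i)) = f (F i) * g (H i)) ->
  f (g ((\prod_(i <- r) F i) * \prod_(i <- r) H i)) =
  f (\prod_(i <- r) F i) * g (\prod_(i <- r) H i).
Proof.
move=> fgFH; rewrite -big_split /= !rmorph_prod -big_split /=.
by apply: eq_bigr => i _; exact: fgFH.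
Qed.

Lemma prod_parallelogram :
  (forall i, f (g (F i)) * F i = f (F i) * g (F i)) ->
  f (g (\prod_(i <- r) F i)) * (\prod_(i <- r) F i) =
  f (\prod_(i <- r) F i) * g (\prod_(i <- r) F i).
Proof.
move=> fgF; rewrite !rmorph_prod -!big_split /=.
by apply: eq_bigr => i _; exact: fgF.
Qed.

End ProdMorphisms.

Section Incidence.
Variables (V : eqType) (E : choiceType) (G : multiquiver V E).
Implicit Types (e : E) (v w : V).

(** A source contributes minus a natural number, which is never positive. *)
Lemma incidence_gt0_target e v :
  0 < incidence G e v -> exists n, mq_target G e = Some (v, n).
Proof.
rewrite /incidence; case: (mq_target G e) => [[u n]|] /=.
  case: eqP => [->|_]; first by exists n.
  by case: (multiplicity_at _ v) => // m; rewrite oppr_gt0.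
by case: (multiplicity_at _ v) => // m; rewrite oppr_gt0.
Qed.

Lemma incidence_lt0_source e v :
  incidence G e v < 0 -> exists n, mq_source G e = Some (v, n).
Proof.
rewrite /incidence; case: (multiplicity_at _ v) => [//|].
case: (mq_source G e) => [[u n]|] //=.
by case: eqP => [->|//]; exists n.
Qed.

(** An edge has at most one target. *)
Lemma incidence_gt0_inj e v w :
  0 < incidence G e v -> 0 < incidence G e w -> v = w.
Proof.
by move=> /incidence_gt0_target[n tv] /incidence_gt0_target[m]; rewrite tv => -[].
Qed.

Lemma incidence_lt0_inj e v w :
  incidence G e v < 0 -> incidence G e w < 0 -> v = w.
Proof.
by move=> /incidence_lt0_source[n sv] /incidence_lt0_source[m]; rewrite sv => -[].
Qed.

(** Pigeonhole: among three nonzero incidences two share a sign, which forces two of the vertices to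
    coincide. *)
Lemma incidence_three e (i j l : V) : i <> j -> j <> l -> i <> l ->
  [\/ incidence G e i = 0, incidence G e j = 0 | incidence G e l = 0].
Proof.
move=> ij jl il.
have P := @incidence_gt0_inj e; have N := @incidence_lt0_inj e.
case: (ltrgt0P (incidence G e i)) => [Pi|Ni|->]; last by constructor 1.
  case: (ltrgt0P (incidence G e j)) => [Pj|Nj|->]; last by constructor 2.
    by case: ij; exact: P.
  case: (ltrgt0P (incidence G e l)) => [Pl|Nl|->]; last by constructor 3.
    by case: il; exact: P.
  by case: jl; exact: N.
case: (ltrgt0P (incidence G e j)) => [Pj|Nj|->]; last by constructor 2.
  case: (ltrgt0P (incidence G e l)) => [Pl|Nl|->]; last by constructor 3.
    by case: jl; exact: P.
  by case: il; exact: N.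
by case: ij; exact: N.
Qed.

End Incidence.

Section Consistency.
Variables (k : fieldType) (V : eqType) (E : choiceType) (G : multiquiver V E).
Local Notation RE := (polyalg k E).

Lemma tfactorE e v :
  tfactor k G e v = signed_rising (pvar k e : RE) (incidence G e v).
Proof.
by rewrite /tfactor; case: (incidence G e v) => // n; rewrite signed_rising_Negz.
Qed.

Lemma tfactor_consistency2 e i j : i <> j ->
  tgw_sigma k G i (tgw_sigma k G j (tfactor k G e i * tfactor k G e j)) =
  tgw_sigma k G i (tfactor k G e i) * tgw_sigma k G j (tfactor k G e j).
Proof.
move=> ij; rewrite (tfactorE e i) (tfactorE e j).
apply: (shift_exchange (tgw_sigmaX k G i e) (tgw_sigmaX k G j e)) => [gt0|lt0];
  rewrite leNgt; apply/negP.
  by move=> /(incidence_gt0_inj gt0).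
by move=> /(incidence_lt0_inj lt0).
Qed.

Lemma tfactor_consistency3 e i j l : i <> j -> j <> l -> i <> l ->
  tgw_sigma k G i (tgw_sigma k G l (tfactor k G e j)) * tfactor k G e j =
  tgw_sigma k G i (tfactor k G e j) * tgw_sigma k G l (tfactor k G e j).
Proof.
move=> ij jl il; rewrite (tfactorE e j).
apply: (shift_parallelogram (tgw_sigmaX k G i e) (tgw_sigmaX k G l e)).
exact: incidence_three.
Qed.

Lemma tgw_t_fset v (D : {fset E}) :
  (forall e, tfactor k G e v <> 1 -> e \in D) ->
  tgw_t k G v = \prod_(e <- D) tfactor k G e v.
Proof.
move=> sD; apply: fsbigTE => e eD.
by apply: contrapT => /sD; rewrite (negbTE eD).
Qed.

(** A common finite index set lets the two products be merged edge by edge; the union of both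
    supports serves. *)
Lemma exists_tgw_t_fset i j : exists D : {fset E},
  tgw_t k G i = \prod_(e <- D) tfactor k G e i /\
  tgw_t k G j = \prod_(e <- D) tfactor k G e j.
Proof.
have [Di defi] := finite_fsetP.1 (finite_tfactor k G i).
have [Dj defj] := finite_fsetP.1 (finite_tfactor k G j).
exists (Di `|` Dj)%fset; split; apply: tgw_t_fset => e; rewrite in_fsetU => te.
  by have : [set` Di]%classic e by [rewrite -defi]; move=> /= ->.
by have : [set` Dj]%classic e by [rewrite -defj]; move=> /= ->; rewrite orbT.
Qed.

End Consistency.

Theorem theorem2p4 (k : fieldType) (k_char0 : [pchar k] =i pred0)
    (V : eqType) (E : choiceType) (G : multiquiver V E) :
  (forall i j : V, i <> j ->
     tgw_sigma k G i (tgw_sigma k G j (tgw_t k G i * tgw_t k G j)) =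
     tgw_sigma k G i (tgw_t k G i) * tgw_sigma k G j (tgw_t k G j)) /\
  (forall i j l : V, i <> j -> j <> l -> i <> l ->
     tgw_sigma k G i (tgw_sigma k G l (tgw_t k G j)) * tgw_t k G j =
     tgw_sigma k G i (tgw_t k G j) * tgw_sigma k G l (tgw_t k G j)).
Proof.
split=> [i j ij|i j l ij jl il].
  have [D [-> ->]] := exists_tgw_t_fset k G i j.
  by apply: prod_exchange => e; exact: tfactor_consistency2.
(* Only [t_j] occurs here, so both vertices are taken to be j. *)
have [D [-> _]] := exists_tgw_t_fset k G j j.
by apply: prod_parallelogram => e; exact: tfactor_consistency3.
Qed.
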